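(* Let $X$ be a non-empty set, let $f,g$ be permutations of $X$ with $fg=gf$, and let $(X,r)$ be the Lyubashenko solution $r(x,y)=(f(y),g(x))$ for $x,y\in X$. Then the following are equivalent: (1) $(X,r)$ is finitely generated; (2) $(X,r)$ satisfies max-sub; (3) $(X,r)$ satisfies min-sub; (4) $X$ has a finite number of orbits under the action of the group $\langle f,g\rangle\leq \operatorname{Sym}_X$.
   Context: A solution (of the Yang–Baxter equation) is a pair $(X,r)$ with $X$ a non-empty set and $r\colon X\times X\to X\times X$, $r(x,y)=(\lambda_x(y),\rho_y(x))$, such that $r_{12}r_{23}r_{12}=r_{23}r_{12}r_{23}$ on $X^3$, where $r_{12}=r\times\mathrm{id}_X$, $r_{23}=\mathrm{id}_X\times r$, and such that all maps $\lambda_x$ and $\rho_x$ are bijective (non-degeneracy). For commuting permutations $f,g$ of $X$, the map $r(x,y)=(f(y),g(x))$ gives a solution, called a Lyubashenko solution. A subsolution of $(X,r)$ is a subset $Y\subseteq X$ such that $r$ restricts to $Y\times Y$ and $(Y,r|_{Y\times Y})$ is a (non-degenerate) solution. For $Y\subseteq X$, $\overline{Y}$ is the intersection of all subsolutions of $(X,r)$ containing $Y$; $(X,r)$ is finitely generated if $X=\overline{Y}$ for some finite $Y\subseteq X$. $(X,r)$ satisfies max-sub (resp. min-sub) if the set of its subsolutions, ordered by inclusion, satisfies the maximal (resp. minimal) condition. *)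

(* Defs.v *)
From mathcomp Require Import all_boot.
From mathcomp Require Import boolp classical_sets functions cardinality.

Set Implicit Arguments.
Unset Strict Implicit.
Unset Printing Implicit Defensive.

Local Open Scope classical_set_scope.

Section Solutions.
Variable X : Type.
Implicit Types (r : X * X -> X * X) (Y : set X).

(* r (x, y) = (lambda_ r x y, rho_ r y x) *)
Definition lambda_ r (x y : X) : X := (r (x, y)).1.
Definition rho_ r (y x : X) : X := (r (x, y)).2.

Definition r12 r (t : X * X * X) : X * X * X :=
  let: (x, y, z) := t in let: (u, v) := r (x, y) in (u, v, z).
Definition r23 r (t : X * X * X) : X * X * X :=
  let: (x, y, z) := t in let: (v, w) := r (y, z) in (x, v, w).

Definition is_solution r : Prop :=
  [/\ inhabited X,
      r12 r \o r23 r \o r12 r =1 r23 r \o r12 r \o r23 r,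
      forall x, bijective (lambda_ r x) &
      forall x, bijective (rho_ r x)].

End Solutions.

Section Subsolutions.
Variables (X : Type) (r : X * X -> X * X).
Implicit Types Y : set X.

(* [set_type Y] is the type of elements of Y; [s], determined uniquely by the
   first condition, is the restriction of r to Y x Y, and exists exactly when
   r maps Y x Y into itself. A subsolution is in particular non-empty. *)
Definition subsolution Y : Prop :=
  exists2 s : set_type Y * set_type Y -> set_type Y * set_type Y,
    (forall x y, r (val x, val y) = (val (s (x, y)).1, val (s (x, y)).2)) &
    is_solution s.

Definition generated_subsolution Y : set X :=
  \bigcap_(Z in [set Z | subsolution Z /\ Y `<=` Z]) Z.

Definition finitely_generated : Prop :=
  exists2 Y : set X, finite_set Y & generated_subsolution Y = setT.

Definition max_sub : Prop :=
  forall F : set (set X), F `<=` subsolution -> F !=set0 ->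
  exists2 M, F M & forall N, F N -> M `<=` N -> N = M.

Definition min_sub : Prop :=
  forall F : set (set X), F `<=` subsolution -> F !=set0 ->
  exists2 M, F M & forall N, F N -> N `<=` M -> N = M.

End Subsolutions.

Definition lyubashenko (X : Type) (f g : X -> X) (p : X * X) : X * X :=
  (f p.2, g p.1).

Section PermutationGroups.
Variable X : Type.

(* Subgroups of Sym_X, as sets of bijective self-maps of X. *)
Definition Sym_subgroup (H : set (X -> X)) : Prop :=
  [/\ H `<=` [set h | bijective h],
      H id,
      (forall h k, H h -> H k -> H (h \o k)) &
      (forall h k, H h -> cancel h k -> cancel k h -> H k)].

Definition Sym_generated (S : set (X -> X)) : set (X -> X) :=
  smallest Sym_subgroup S.

Definition perm_orbit (H : set (X -> X)) (x : X) : set X :=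
  [set h x | h in H].

Definition perm_orbits (H : set (X -> X)) : set (set X) :=
  range (perm_orbit H).

End PermutationGroups.

Lemma lyubashenko_solution (X : Type) (f g : X -> X) :
  inhabited X -> bijective f -> bijective g -> f \o g =1 g \o f ->
  is_solution (lyubashenko f g).
Proof.
move=> X0 bf bg fg; split=> // [[[x y] z]] /=.
by rewrite /lyubashenko /=; congr (_, _, _); exact/esym/fg.
Qed.

(* Main.v *)
(** Write G for the group generated by f and g. The subsolutions of (X, r) are
    exactly the non-empty unions of G-orbits, so each condition says something
    about the lattice of G-stable sets. A set Y generates X, possibly after
    adding a point to it, iff it meets every orbit. A maximal finite union of
    orbits is X. If there were infinitely many orbits, then no set obtained from
    X by removing finitely many of them would be minimal. Conversely, if a
    finite set Y meets every orbit then stable sets are compared through their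
    traces on Y, which leaves finitely many possibilities. *)

Require Import Defs.
From mathcomp Require Import all_boot.
From mathcomp Require Import boolp classical_sets functions cardinality.

Set Implicit Arguments.
Unset Strict Implicit.
Unset Printing Implicit Defensive.

Local Open Scope classical_set_scope.

(** * Families of sets compared through their traces on a finite set *)

(** Induction on [A]. If some member of [F] contains the new point [a], the search is confined to
    such members, whose traces can differ only on the remaining points. Otherwise no member contains
    [a], and [a] never affects the comparison. *)
Lemma max_trace (T : Type) (A : set T) (F : set (set T)) :
  finite_set A -> F !=set0 ->
  exists2 M, F M & forall N, F N -> A `&` M `<=` N -> A `&` N `<=` M.
Proof.
(* [Peq] equips [T] with a decidable equality, so that [A] can be listed as a sequence. *)
elim/Peq: T => T in A F *; move=> /finite_seqP[s ->].
elim: s F => [|a s IHs] F F0.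
  by have [M FM] := F0; exists M => // N _ _ x [].
have [Fa0|Fa0] := pselect ((F `&` [set M | M a]) !=set0).
  have [M [FM Ma] Mmax] := IHs _ Fa0.
  exists M => // N FN MN x [/=]; rewrite inE => /predU1P[-> //|xs] Nx.
  apply: (Mmax N) => // [|y [ys My]]; last first.
    by apply: MN; split=> //=; rewrite inE ys orbT.
  by split=> //; apply: MN; split=> //=; rewrite inE eqxx.
have [M FM Mmax] := IHs _ F0.
exists M => // N FN MN x [/=]; rewrite inE => /predU1P[->|xs] Nx.
  by case: Fa0; exists N.
by apply: (Mmax N) => // y [ys My]; apply: MN; split=> //=; rewrite inE ys orbT.
Qed.

(** Dual to [max_trace]: complementation reverses inclusions of traces on [A]. *)
Lemma min_trace (T : Type) (A : set T) (F : set (set T)) :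
  finite_set A -> F !=set0 ->
  exists2 M, F M & forall N, F N -> A `&` N `<=` M -> A `&` M `<=` N.
Proof.
move=> Afin [Z FZ].
have [|_ [M FM <-] Mmax] := @max_trace T A (setC @` F) Afin.
  by exists (~` Z), Z.
exists M => // N FN NM x [Ax Mx]; apply: contrapT => Nx.
suff : (~` M) x by [].
apply: (Mmax (~` N)) => [|y [Ay nMy] Ny|//]; first by exists N.
exact: nMy (NM _ _).
Qed.

(** * Sets stable under a set of permutations, and orbits of the generated group *)

Section StableSets.
Variable X : Type.
Implicit Types (S : set (X -> X)) (Y Z : set X).

(** The equivalence encodes stability under [h] and its inverse at once, so [S] need not be closed
    under inverses, and complements of stable sets are stable. *)
Definition stable_set S Z : Prop := forall h x, S h -> Z (h x) <-> Z x.

Lemma stable_setC S Z : stable_set S Z -> stable_set S (~` Z).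
Proof. by move=> SZ h x Sh; split; apply: contra_not => /(SZ h x Sh). Qed.

Lemma stable_bigcup S (I : Type) (D : set I) (F : I -> set X) :
  (forall i, D i -> stable_set S (F i)) -> stable_set S (\bigcup_(i in D) F i).
Proof.
by move=> SF h x Sh; split=> -[i Di Fi]; exists i => //; apply/(SF i Di h x Sh).
Qed.

Variable S : set (X -> X).
Hypothesis S_bij : S `<=` [set h | bijective h].

Local Notation orbit := (perm_orbit (Sym_generated S)).

Lemma Sym_generated_subgroup : Sym_subgroup (Sym_generated S).
Proof.
split.
- apply: smallest_sub => //; split=> //.
  + by exists id.
  + by move=> h k /= bh bk; exact: bij_comp.
  + by move=> h k _ hk kh; exists h.
- by move=> H [[_ H1 _ _] _].
- move=> h k Gh Gk H HS; case: (HS) => -[_ _ HM _] _.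
  by apply: HM; [exact: Gh|exact: Gk].
- move=> h k Gh hk kh H HS; case: (HS) => -[_ _ _ HV] _.
  by apply: HV hk kh; exact: Gh.
Qed.

(** The permutations that preserve membership in [Z] in both directions form a subgroup, and it
    contains [S]. *)
Lemma stable_Sym_generated Z : stable_set S Z -> stable_set (Sym_generated S) Z.
Proof.
move=> SZ h x Gh.
suff: Sym_generated S `<=` [set h | bijective h /\ forall x, Z (h x) <-> Z x].
  by move=> /(_ h Gh)[_]; exact.
apply: smallest_sub => [|k Sk]; last by split=> [|y]; [exact: S_bij|exact: SZ].
split=> [k []//||k l [bk Zk] [bl Zl]|k l [bk Zk] kl lk].
- by split=> //; exists id.
- by split=> [|y]; [exact: bij_comp|rewrite /= Zk].
- by split=> [|y]; [exists k|rewrite -{2}(lk y) Zk].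
Qed.

Lemma orbit_refl x : orbit x x.
Proof. by have [_ G1 _ _] := Sym_generated_subgroup; exists id. Qed.

Lemma stable_orbit x : stable_set S (orbit x).
Proof.
have [_ _ GM GV] := Sym_generated_subgroup.
move=> h y Sh; have Gh : Sym_generated S h by exact: sub_gen_smallest.
split=> [[k Gk kxhy]|[k Gk <-]]; last by exists (h \o k) => //; exact: GM.
have [h' hK h'K] := S_bij Sh.
exists (h' \o k); last by rewrite /= kxhy hK.
by apply: GM => //; exact: GV Gh hK h'K.
Qed.

Lemma orbit_sub Z x : stable_set S Z -> Z x -> orbit x `<=` Z.
Proof.
by move=> SZ Zx _ [h Gh <-]; apply/(stable_Sym_generated SZ x Gh).
Qed.

Lemma orbit_sym x y : orbit x y -> orbit y x.
Proof.
have [Gb _ _ GV] := Sym_generated_subgroup.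
move=> [h Gh <-]; have [k hK kK] := Gb h Gh.
by exists k => //; exact: GV Gh hK kK.
Qed.

Lemma orbit_eq x y : orbit x y -> orbit x = orbit y.
Proof.
move=> xy; apply/seteqP; split; apply: orbit_sub => //; try exact: stable_orbit.
exact: orbit_sym.
Qed.

Lemma finite_orbitsP : inhabited X ->
  finite_set (perm_orbits (Sym_generated S)) <->
  exists2 Y, finite_set Y & \bigcup_(y in Y) orbit y = setT.
Proof.
move=> [x0]; split=> [fin|[Y Yfin YT]].
  (* [rep] picks a point of each orbit; [x0] is a dummy value on sets that are not orbits. *)
  have /choice[rep repP] (O : set X) : exists y, range orbit O -> orbit y = O.
    by have [[y _ <-]|nO] := pselect (range orbit O); [exists y|exists x0].
  exists (rep @` perm_orbits (Sym_generated S)); first exact: finite_image.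
  apply/seteqP; split=> // x _; have Ox : range orbit (orbit x) by exists x.
  exists (rep (orbit x)); first by exists (orbit x).
  by rewrite (repP _ Ox); exact: orbit_refl.
apply: (@sub_finite_set _ _ (orbit @` Y)); last exact: finite_image.
move=> _ [x _ <-]; have [y Yy yx] : (\bigcup_(y in Y) orbit y) x by rewrite YT.
by exists y => //; exact: orbit_eq.
Qed.

(** A point of [Z] shares its orbit with some [y] in [Y]. Stability carries membership from the
    point to [y] inside [Z], and back from [y] to the point inside [Z']. *)
Lemma sub_stable_trace Y Z Z' :
  \bigcup_(y in Y) orbit y = setT -> stable_set S Z -> stable_set S Z' ->
  Y `&` Z `<=` Z' -> Z `<=` Z'.
Proof.
move=> YT SZ SZ' ZZ' x Zx.
have [y Yy yx] : (\bigcup_(y in Y) orbit y) x by rewrite YT.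
apply: (orbit_sub SZ') (yx); apply: ZZ'; split=> //.
by apply: (orbit_sub SZ Zx); exact: orbit_sym.
Qed.

End StableSets.

(** * Subsolutions of a Lyubashenko solution and the four finiteness conditions *)

Section Lyubashenko.
Variables (X : Type) (X0 : inhabited X) (f g : X -> X).
Hypotheses (f_bij : bijective f) (g_bij : bijective g).
Hypothesis fgC : f \o g =1 g \o f.

Local Notation r := (lyubashenko f g).
Local Notation S := [set f; g].
Local Notation orbit := (perm_orbit (Sym_generated S)).

Let S_bij : S `<=` [set h | bijective h].
Proof. by move=> h [] ->. Qed.

(** On a subsolution the maps [lambda_] and [rho_] are restrictions of [f] and [g], so
    non-degeneracy says that [f] and [g] map [Y] onto itself. Conversely, they then restrict to
    commuting permutations of [Y], which define a Lyubashenko solution there. *)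
Lemma subsolution_lyubashenkoP Y :
  subsolution r Y <-> Y !=set0 /\ stable_set S Y.
Proof.
split=> [[s sE [[y0] _ lam_bij rho_bij]]|[[y0 Yy0] SY]].
  have mkY (x : X) : Y x -> {y : set_type Y | val y = x}.
    by move=> Yx; exists (exist _ x (mem_set Yx)).
  have Yval (y : set_type Y) : Y (val y) by exact: set_valP.
  have lamE x y : val (lambda_ s x y) = f (val y) by have [-> _] := sE x y.
  have rhoE x y : val (rho_ s x y) = g (val y) by have [_ ->] := sE y x.
  split=> [|h x [->|->]]; first by exists (val y0).
  - split=> [/mkY[y yE]|/mkY[y <-]]; last by rewrite -(lamE y y).
    (* Here [y] is the image of [x] under [f]; its preimage [l y] inside [Y] must be [x], by
       injectivity of [f]. *)
    have [l _ lK] := lam_bij y.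
    have := lamE y (l y); rewrite lK yE => /(bij_inj f_bij) ->; exact: Yval.
  - split=> [/mkY[y yE]|/mkY[y <-]]; last by rewrite -(rhoE y y).
    have [l _ lK] := rho_bij y.
    have := rhoE y (l y); rewrite lK yE => /(bij_inj g_bij) ->; exact: Yval.
have restr h : S h -> {hY : set_type Y -> set_type Y |
    bijective hY & forall y, val (hY y) = h (val y)}.
  move=> Sh; have /cid2[k kh hk] : exists2 k, cancel h k & cancel k h.
    by case: (S_bij Sh) => k; exists k.
  have hY (y : set_type Y) : h (val y) \in Y.
    by apply/mem_set/(SY h (val y) Sh); exact: set_valP.
  have kY (y : set_type Y) : k (val y) \in Y.
    by apply/mem_set/(SY h _ Sh); rewrite hk; exact: set_valP.
  exists (fun y => SigSub (hY y)) => //.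
  by exists (fun y => SigSub (kY y)) => y; apply: val_inj; rewrite /= ?kh ?hk.
have [fY fY_bij fYE] := restr f (or_introl erefl).
have [gY gY_bij gYE] := restr g (or_intror erefl).
exists (lyubashenko fY gY) => [x y|]; first by rewrite /= fYE gYE.
apply: lyubashenko_solution => //; first by split; exists y0; exact: mem_set.
by move=> y; apply: val_inj; rewrite [LHS]fYE gYE [RHS]gYE fYE; exact: fgC.
Qed.

Lemma subsolution_bigcup_orbit Y :
  Y !=set0 -> subsolution r (\bigcup_(y in Y) orbit y).
Proof.
move=> [y Yy]; apply/subsolution_lyubashenkoP; split.
  by exists y, y => //; exact: orbit_refl.
by apply: stable_bigcup => i _; exact: stable_orbit.
Qed.

Lemma finitely_generated_finite_orbits :
  finitely_generated r -> finite_set (perm_orbits (Sym_generated S)).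
Proof.
move=> [Y Yfin YT]; apply/finite_orbitsP => //; have [x0] := X0.
(* [Y] may be empty, while a subsolution is not; adding [x0] makes the union of orbits a
   subsolution. *)
exists (x0 |` Y); first by rewrite finite_setU.
apply/seteqP; split=> // x _.
have : generated_subsolution r Y x by rewrite YT.
apply; split; first by apply: subsolution_bigcup_orbit; exists x0; left.
by move=> y Yy; exists y; [right|exact: orbit_refl].
Qed.

Lemma finite_orbits_finitely_generated :
  finite_set (perm_orbits (Sym_generated S)) -> finitely_generated r.
Proof.
move=> /finite_orbitsP[]// Y Yfin YT; exists Y => //.
apply/seteqP; split=> // x _ Z [/subsolution_lyubashenkoP[_ SZ] YZ].
have [y Yy yx] : (\bigcup_(y in Y) orbit y) x by rewrite YT.
exact: orbit_sub (YZ y Yy) _ yx.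
Qed.

Lemma finite_orbits_max_sub :
  finite_set (perm_orbits (Sym_generated S)) -> max_sub r.
Proof.
move=> /finite_orbitsP[]// Y Yfin YT F Fsub F0.
have Fst Z : F Z -> stable_set S Z by move=> /Fsub/subsolution_lyubashenkoP[].
have [M FM Mmax] := max_trace Yfin F0; exists M => // N FN MN.
apply/seteqP; split=> //; apply: sub_stable_trace YT _ _ _ => //.
- exact: Fst.
- exact: Fst.
- by apply: Mmax => // x [_ /MN].
Qed.

Lemma finite_orbits_min_sub :
  finite_set (perm_orbits (Sym_generated S)) -> min_sub r.
Proof.
move=> /finite_orbitsP[]// Y Yfin YT F Fsub F0.
have Fst Z : F Z -> stable_set S Z by move=> /Fsub/subsolution_lyubashenkoP[].
have [M FM Mmin] := min_trace Yfin F0; exists M => // N FN NM.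
apply/seteqP; split=> //; apply: sub_stable_trace YT _ _ _ => //.
- exact: Fst.
- exact: Fst.
- by apply: Mmin => // x [_ /NM].
Qed.

Lemma max_sub_finite_orbits :
  max_sub r -> finite_set (perm_orbits (Sym_generated S)).
Proof.
move=> maxr; apply/finite_orbitsP => //; have [x0] := X0.
pose F := [set \bigcup_(y in Y) orbit y | Y in
             [set Y : set X | finite_set Y /\ Y !=set0]].
have [||_ [Y [Yfin Y0] <-] Ymax] := maxr F.
- by move=> _ [Y [_ Y0] <-]; exact: subsolution_bigcup_orbit.
- exists (\bigcup_(y in [set x0]) orbit y), [set x0] => //.
  by split=> //; exists x0.
exists Y => //; apply/seteqP; split=> // x _.
(* Adjoining the orbit of [x] cannot enlarge a maximal union, so [x] was already covered. *)
rewrite -(Ymax (\bigcup_(y in x |` Y) orbit y)).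
- by exists x; [left|exact: orbit_refl].
- by exists (x |` Y) => //; split; [rewrite finite_setU|exists x; left].
- by apply: bigcup_subset => y; right.
Qed.

Lemma min_sub_finite_orbits :
  min_sub r -> finite_set (perm_orbits (Sym_generated S)).
Proof.
move=> minr; apply: contrapT => inf.
have cofin_n0 Y : finite_set Y -> ~` (\bigcup_(y in Y) orbit y) !=set0.
  move=> Yfin; apply/set0P/eqP => YT; apply/inf/finite_orbitsP => //.
  by exists Y => //; rewrite -[LHS]setCK YT setC0.
pose F := [set ~` (\bigcup_(y in Y) orbit y) | Y in
             [set Y : set X | finite_set Y]].
have [||_ [Y Yfin <-] Ymin] := minr F.
- move=> _ [Y Yfin <-]; apply/subsolution_lyubashenkoP; split.
    exact: cofin_n0.
  by apply/stable_setC/stable_bigcup => y _; exact: stable_orbit.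
- by exists (~` (\bigcup_(y in set0) orbit y)), set0 => /=.
(* Some [x] survives in the minimal member; removing its orbit too gives a member of [F] that by
   minimality is the same set, yet misses [x]. *)
have [x xY] := cofin_n0 _ Yfin.
have := xY; rewrite -(Ymin (~` (\bigcup_(y in x |` Y) orbit y))).
- by apply; exists x; [left|exact: orbit_refl].
- by exists (x |` Y) => //=; rewrite finite_setU.
- by apply/subsetC/bigcup_subset => y; right.
Qed.

End Lyubashenko.

Unset Implicit Arguments.

Theorem corollary4p13 (X : Type) (X0 : inhabited X) (f g : X -> X)
    (f_bij : bijective f) (g_bij : bijective g) (fgC : f \o g =1 g \o f) :
  [<-> finitely_generated (lyubashenko f g);
       max_sub (lyubashenko f g);
       min_sub (lyubashenko f g);
       finite_set (perm_orbits (Sym_generated [set f; g]))].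
Proof.
tfae.
- move=> /(finitely_generated_finite_orbits X0 f_bij g_bij fgC).
  exact: finite_orbits_max_sub.
- move=> /(max_sub_finite_orbits X0 f_bij g_bij fgC).
  exact: finite_orbits_min_sub.
- exact: min_sub_finite_orbits.
- exact: finite_orbits_finitely_generated.
Qed.
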